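(* Let $A$ be a finite nonempty alphabet and let $S\subset A^*$ be a recurrent connected set with $A\subset S$. Then for every $n\ge 0$ and every vertex $v$ of the Rauzy graph $G_n(S)$, the group described by $G_n(S)$ with respect to $v$ is the free group $F_A$.
   Context: $S$ is factorial if it contains all factors of its elements; it is recurrent if $S\ne\{1\}$, $S$ is factorial, and for all $u,w\in S$ there is $v\in S$ with $uvw\in S$. For $w\in S$: $L(w)=\{a\in A\mid aw\in S\}$, $R(w)=\{a\in A\mid wa\in S\}$, $E(w)=\{(a,b)\mid awb\in S\}$; $S$ is biextendable if it is factorial and $E(w)\ne\emptyset$ for all $w\in S$. The extension graph of $w$ is the undirected bipartite graph with vertex set the disjoint union of $L(w)$ and $R(w)$ and an edge $a$–$b$ for each $(a,b)\in E(w)$. $S$ is connected if it is biextendable and every extension graph is connected. The Rauzy graph $G_n(S)$ is the labeled directed graph with vertex set $S\cap A^n$ and an edge $(x,a,y)$ labeled $a\in A$ whenever $x,y\in S\cap A^n$ and $xa\in S\cap Ay$. A generalized path in a labeled graph is a sequence $(p_0,a_1,p_1,\dots,a_m,p_m)$ with $a_i\in A\cup A^{-1}$ such that there is an edge $(p_{i-1},a_i,p_i)$ if $a_i\in A$ and an edge $(p_i,a_i^{-1},p_{i-1})$ if $a_i\in A^{-1}$; its label is the reduced word equivalent to $a_1\cdots a_m$, an element of $F_A$. The group described by the graph with respect to a vertex $v$ is the set of labels of generalized paths from $v$ to $v$. *)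

(* Defs.v *)
From HB Require Import structures.
From Stdlib Require Import Relation_Operators.
From mathcomp Require Import all_boot.
From mathcomp Require Import boolp classical_sets.

Set Implicit Arguments.
Unset Strict Implicit.
Unset Printing Implicit Defensive.

Local Open Scope classical_set_scope.

(* The free group on A, realized on reduced words over A and A^-1.            *)
(* The letter (a, false) stands for a and (a, true) for a^-1.                 *)
Section FreeGroup.
Variable A : choiceType.
Implicit Types (x y : A * bool) (u v w : seq (A * bool)).

Definition linv x : A * bool := (x.1, ~~ x.2).

Definition reduced w : bool := sorted (fun x y => y != linv x) w.

Definition push x w :=
  if w is y :: w' then if y == linv x then w' else x :: w else [:: x].

Definition reduce w := foldr push [::] w.

Lemma linvK : involutive linv.
Proof. by case=> a b; rewrite /linv /= negbK. Qed.

Lemma reduced_behead x w : reduced (x :: w) -> reduced w.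
Proof. exact: path_sorted. Qed.

Lemma push_reduced x w : reduced w -> reduced (push x w).
Proof.
case: w => [|y w] //= Hw; case: ifPn => [_|yx]; first exact: path_sorted Hw.
by rewrite /reduced /= yx.
Qed.

Lemma pushK x w : reduced w -> push x (push (linv x) w) = w.
Proof.
case: w => [|y w] /=; first by rewrite eqxx.
rewrite linvK; case: eqVneq => [->|_]; last by rewrite /= eqxx.
by case: w => [|z w] //= /andP[/negbTE->].
Qed.

Lemma foldr_push_reduced u w : reduced w -> reduced (foldr push w u).
Proof. by move=> Hw; elim: u => //= x u; exact: push_reduced. Qed.

Lemma reduce_reduced w : reduced (reduce w).
Proof. exact: foldr_push_reduced. Qed.

Lemma foldr_push_push x u w : reduced w ->
  foldr push w (push x u) = push x (foldr push w u).
Proof.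
move=> Hw; case: u => [|y u] //=; case: eqVneq => [->|//].
by rewrite pushK //; exact: foldr_push_reduced.
Qed.

Lemma foldr_push_reduce u w : reduced w ->
  foldr push w (reduce u) = foldr push w u.
Proof. by move=> Hw; elim: u => //= x u IH; rewrite foldr_push_push ?IH. Qed.

Lemma reduce_cat u v : reduce (u ++ v) = foldr push (reduce v) u.
Proof. exact: foldr_cat. Qed.

Lemma reduce_id w : reduced w -> reduce w = w.
Proof.
elim: w => //= x w IH Hw; rewrite IH; last exact: path_sorted Hw.
by case: w Hw {IH} => //= y w /andP[/negbTE->].
Qed.

Lemma reduce_catr u v : reduce (u ++ reduce v) = reduce (u ++ v).
Proof. by rewrite !reduce_cat (reduce_id (reduce_reduced v)). Qed.

Lemma reduce_catl u v : reduce (reduce u ++ v) = reduce (u ++ v).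
Proof. by rewrite !reduce_cat foldr_push_reduce // reduce_reduced. Qed.

Lemma reduce_cancel u x v : reduce (u ++ x :: linv x :: v) = reduce (u ++ v).
Proof. by rewrite !reduce_cat /= pushK // reduce_reduced. Qed.

Definition winv w := rev (map linv w).

Lemma winv_reduced w : reduced w -> reduced (winv w).
Proof.
rewrite /reduced /winv rev_sorted sorted_map; apply: sub_sorted => x y /=.
by apply: contra => /eqP/(inv_inj linvK) ->; rewrite linvK.
Qed.

Lemma winvK : involutive winv.
Proof. by move=> w; rewrite /winv map_rev revK (mapK linvK). Qed.

Lemma reduce_catV w : reduce (w ++ winv w) = [::].
Proof.
elim: w => //= x w IH.
rewrite /winv /= rev_cons -cats1 catA -/(winv w) -reduce_catl IH /=.
by rewrite eqxx.
Qed.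

Definition freely_equivalent : seq (A * bool) -> seq (A * bool) -> Prop :=
  clos_refl_sym_trans _
    (fun u v => exists s x t, u = s ++ x :: linv x :: t /\ v = s ++ t).

Lemma freely_equivalent_cons x u v :
  freely_equivalent u v -> freely_equivalent (x :: u) (x :: v).
Proof.
elim=> {u v} [u v [s [y [t [-> ->]]]] | u | u v _ | u v w _ IH1 _ IH2].
- by apply: rst_step; exists (x :: s), y, t.
- exact: rst_refl.
- exact: rst_sym.
- exact: rst_trans IH1 IH2.
Qed.

Lemma freely_equivalent_reduce w : freely_equivalent w (reduce w).
Proof.
elim: w => [|x w /(freely_equivalent_cons x) IH] /=; first exact: rst_refl.
apply: rst_trans IH _; case: (reduce w) => [|y u] /=; first exact: rst_refl.
case: eqVneq => [->|_]; last exact: rst_refl.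
by apply: rst_step; exists [::], x, u.
Qed.

(* [reduce w] is the unique reduced word equivalent to [w]. *)
Lemma reduceP u w : reduced u /\ freely_equivalent w u <-> u = reduce w.
Proof.
split=> [[Hu Huw]|->]; last first.
  by split; [exact: reduce_reduced | exact: freely_equivalent_reduce].
rewrite -(reduce_id Hu); elim: Huw => {u w Hu} //.
- by move=> u v [s [x [t [-> ->]]]]; rewrite reduce_cancel.
- by move=> u v w _ IH1 _ IH2; rewrite IH2.
Qed.

Record freegroup := FreeGroup { fgval :> seq (A * bool); _ : reduced fgval }.

HB.instance Definition _ := [isSub for fgval].
HB.instance Definition _ := [Choice of freegroup by <:].

Definition fgword w : freegroup := FreeGroup (reduce_reduced w).
Definition fgone : freegroup := fgword [::].
Definition fgmul (g h : freegroup) : freegroup := fgword (g ++ h).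
Definition fginv (g : freegroup) : freegroup := FreeGroup (winv_reduced (valP g)).

Lemma fgmulA : associative fgmul.
Proof.
by move=> f g h; apply: val_inj; rewrite /= reduce_catl reduce_catr catA.
Qed.

Lemma fg1mul : left_id fgone fgmul.
Proof. by move=> g; apply: val_inj; rewrite /= reduce_id // (valP g). Qed.

Lemma fgmul1 : right_id fgone fgmul.
Proof. by move=> g; apply: val_inj; rewrite /= cats0 reduce_id // (valP g). Qed.

Lemma fgmulV : right_inverse fgone fginv fgmul.
Proof. by move=> g; apply: val_inj; rewrite /= reduce_catV. Qed.

Lemma fgVmul : left_inverse fgone fginv fgmul.
Proof.
by move=> g; apply: val_inj; rewrite /= -[X in _ ++ X]winvK reduce_catV.
Qed.

HB.instance Definition _ := isGroup.Build freegroup fgmulA fg1mul fgmul1 fgVmul fgmulV.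

End FreeGroup.

Record labeled_graph (A V : Type) := LabeledGraph {
  vertices : set V;
  edge : V -> A -> V -> Prop
}.

Section Described.
Variables (A : choiceType) (V : Type) (G : labeled_graph A V).

Definition gstep (p : V) (x : A * bool) (q : V) : Prop :=
  if x.2 then edge G q x.1 p else edge G p x.1 q.

(* The sequence (p, a_1, p_1, .., a_m, p_m) is given as p and                 *)
(* s = [:: (a_1, p_1); .. ; (a_m, p_m)].                                      *)
Fixpoint gpath (p : V) (s : seq ((A * bool) * V)) : Prop :=
  if s is (x, q) :: s' then gstep p x q /\ gpath q s' else vertices G p.

Definition gpath_label (s : seq ((A * bool) * V)) : freegroup A :=
  fgword (unzip1 s).

Definition group_described (v : V) : set (freegroup A) :=
  [set g | exists s,
     [/\ gpath v s, last v (unzip2 s) = v & g = gpath_label s]].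

End Described.

Section Languages.
Variables (A : finType) (S : set (seq A)).

Definition factorial_set : Prop :=
  forall u w : seq A, infix u w -> S w -> S u.

Definition recurrent : Prop :=
  [/\ S <> [set [::]], factorial_set &
      forall u w, S u -> S w -> exists2 v, S v & S (u ++ v ++ w)].

Definition left_ext (w : seq A) : set A := [set a | S (a :: w)].
Definition right_ext (w : seq A) : set A := [set a | S (rcons w a)].
Definition bi_ext (w : seq A) : set (A * A) :=
  [set ab | S (ab.1 :: rcons w ab.2)].

Definition biextendable : Prop :=
  factorial_set /\ forall w, S w -> bi_ext w !=set0.

Definition ext_edge (w : seq A) : rel (left_ext w + right_ext w) :=
  fun x y => match x, y with
  | inl a, inr b | inr b, inl a => (val a, val b) \in bi_ext w
  | _, _ => false
  end.

Definition connected_set : Prop :=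
  biextendable /\
  forall w, S w ->
    forall x y : left_ext w + right_ext w, connect (ext_edge (w := w)) x y.

Definition rauzy_graph (n : nat) : labeled_graph A (seq A) :=
  let V := [set w | S w /\ size w = n] in
  LabeledGraph V (fun x a y =>
    [/\ V x, V y, S (rcons x a) & exists b, rcons x a = b :: y]).

End Languages.

(* Main.v *)
Require Import Defs.
From mathcomp Require Import all_boot.
From mathcomp Require Import boolp classical_sets.

Set Implicit Arguments.
Unset Strict Implicit.
Unset Printing Implicit Defensive.

Local Open Scope classical_set_scope.

(** Deleting the first letter maps [G_(n+1)(S)] onto [G_n(S)], and every edge of
    [G_n(S)] lifts because [S] is biextendable. Two vertices [au] and [bu] over
    the same [u] are joined by a generalized path with trivial label: an edge
    [a]-[c] of the extension graph of [u] gives an edge from [au] to [uc] labeled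
    [c], so a walk [a]-[c]-[b] gives the label [c c^-1], and the extension graph
    is connected. Hence labels of paths in [G_n(S)] lift to [G_(n+1)(S)] with
    arbitrary endpoints in the fibres, and [G_0(S)] is a bouquet of loops labeled
    by [A]. *)

Section Reachability.
Variables (A : choiceType) (V : Type) (G : labeled_graph A V).
Implicit Types (p q r : V) (g h : freegroup A).

(** A version of [group_described] with two endpoints, so that labels can be multiplied along
    concatenated paths; for [p = q] it is membership in the described group by conversion. *)
Definition reaches p g q : Prop :=
  exists s, [/\ gpath G p s, last p (unzip2 s) = q & g = gpath_label s].

Lemma reaches_refl p : vertices G p -> reaches p 1%g p.
Proof. by move=> Gp; exists [::]. Qed.

Lemma reaches_trans q p r g h :
  reaches p g q -> reaches q h r -> reaches p (g * h)%g r.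
Proof.
move=> [s [ps lq ->]] [t [qt lr ->]]; exists (s ++ t); split.
- elim: s p ps lq => [|[x p'] s IHs] p /=; first by move=> _ ->.
  by move=> [px ps] lq; split=> //; exact: IHs.
- by rewrite /unzip2 map_cat last_cat -/unzip2 lq.
- by apply: val_inj; rewrite /= reduce_catl reduce_catr /unzip1 map_cat.
Qed.

Lemma reaches_step p x q :
  gstep G p x q -> vertices G q -> reaches p (fgword [:: x]) q.
Proof. by move=> pxq Gq; exists [:: (x, q)]. Qed.

End Reachability.

Arguments reaches {A V} G p g q.

Lemma fgword_cons (A : choiceType) (x : A * bool) (w : seq (A * bool)) :
  fgword (x :: w) = (fgword [:: x] * fgword w)%g.
Proof.
apply: val_inj; symmetry.
exact: etrans (reduce_catl [:: x] _) (reduce_catr [:: x] w).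
Qed.

Lemma fgword_linv (A : choiceType) (x : A * bool) :
  (fgword [:: x] * fgword [:: linv x])%g = 1%g.
Proof. by apply: val_inj; exact: (reduce_catV [:: x]). Qed.

Section RauzyGraphs.
Variables (A : finType) (S : set (seq A)).
Hypothesis S_connected : connected_set S.
Implicit Types (a b c : A) (p q u : seq A) (g : freegroup A).

Lemma connected_factorial : factorial_set S.
Proof. by case: S_connected => -[]. Qed.

Lemma factorial_behead a u : S (a :: u) -> S u.
Proof. by apply: connected_factorial; exact: (infix_catl [:: a] (infix_refl _)). Qed.

Lemma factorial_belast u a : S (rcons u a) -> S u.
Proof.
by apply: connected_factorial; rewrite -cats1; exact: infix_catr (infix_refl _).
Qed.

Lemma left_extend u : S u -> exists a, S (a :: u).
Proof.
case: S_connected => -[_ ext] _ /ext[[a b] /= Saub]; exists a.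
exact: (@factorial_belast (a :: u) b).
Qed.

Lemma rauzy_extension_edge n u a c : size u = n -> S (a :: rcons u c) ->
  edge (rauzy_graph S n.+1) (a :: u) c (rcons u c).
Proof.
move=> un Sauc; split=> //=; last by exists a.
- by split; [exact: (@factorial_belast (a :: u) c) | rewrite un].
- by split; [exact: factorial_behead Sauc | rewrite size_rcons un].
Qed.

Lemma rauzy_fibre n u a b : size u = n -> S (a :: u) -> S (b :: u) ->
  reaches (rauzy_graph S n.+1) (a :: u) 1%g (b :: u).
Proof.
move=> un Sau Sbu.
have Su := factorial_behead Sau.
pose L := left_ext S u; pose R := right_ext S u.
(* Invariant of a walk in the extension graph of [u]: the accumulated label depends only on the
   current vertex. Entering a right vertex [c] reads [c], leaving it reads its inverse, so the label
   is trivial at every left vertex. *)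
pose node (x : L + R) := match x with
  inl d => val d :: u | inr c => rcons u (val c) end.
pose lab (x : L + R) : freegroup A := match x with
  inl _ => 1%g | inr c => fgword [:: (val c, false)] end.
have walk s : forall x : L + R, path (@ext_edge A S u) x s ->
    reaches (rauzy_graph S n.+1) (a :: u) (lab x) (node x) ->
    reaches (rauzy_graph S n.+1) (a :: u) (lab (last x s)) (node (last x s)).
  elim: s => [|y s IHs] x //= /andP[exy ys] ax; apply: IHs ys _.
  case: x y exy ax => [d|c] [d'|c'] //= /set_mem/(rauzy_extension_edge un) e ax.
    rewrite -[fgword _]mul1g; apply: reaches_trans ax _.
    by apply: reaches_step; case: e.
  rewrite -(fgword_linv (val c, false)); apply: reaches_trans ax _.
  by apply: reaches_step; case: e.
have [_ /(_ u Su)] := S_connected.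
move=> /(_ (inl (exist _ a (mem_set (Sau : L a))))
           (inl (exist _ b (mem_set (Sbu : L b)))))/connectP[s xs lb].
have := walk s _ xs; rewrite -lb; apply; apply: reaches_refl.
by split=> //=; rewrite un.
Qed.

(** Extend the word [rcons p a] to the left by some [c]; then [d] is the first letter of
    [rcons p a]. Neither letter is prescribed, and [rauzy_fibre] later corrects this. *)
Lemma rauzy_edge_lift n p a q : edge (rauzy_graph S n) p a q ->
  exists c d, edge (rauzy_graph S n.+1) (c :: p) a (d :: q).
Proof.
move=> [[_ pn] _ Spa [d pa]]; have [c Scpa] := left_extend Spa.
by exists c, d; rewrite -pa; exact: rauzy_extension_edge.
Qed.

Lemma rauzy_step_lift n p x q : gstep (rauzy_graph S n) p x q ->
  exists c d, gstep (rauzy_graph S n.+1) (c :: p) x (d :: q).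
Proof.
rewrite /gstep; case: x.2 => /rauzy_edge_lift [c [d e]]; last by exists c, d.
by exists d, c.
Qed.

Lemma gstep_vertices n p x q : gstep (rauzy_graph S n) p x q ->
  vertices (rauzy_graph S n) p /\ vertices (rauzy_graph S n) q.
Proof. by rewrite /gstep; case: x.2 => -[]. Qed.

Lemma rauzy_reaches_lift n p g q a b : reaches (rauzy_graph S n) p g q ->
  S (a :: p) -> S (b :: q) ->
  reaches (rauzy_graph S n.+1) (a :: p) g (b :: q).
Proof.
(* [a] is generalized because the rest of the path must be lifted from whatever letter the lifted
   first step arrives at. *)
move=> [s [+ + ->]]; elim: s p a => [|[x r] s IHs] p a /=.
  by move=> [_ pn] <-; exact: rauzy_fibre.
move=> [pxr rs] lq Sap Sbq.
have [[_ pn] _] := gstep_vertices pxr.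
have [c [d cxd]] := rauzy_step_lift pxr.
have [[Scp _] Gdr] := gstep_vertices cxd; have [Sdr _] := Gdr.
(* Move inside the fibre over [p], with trivial label, to the start [c :: p] of the lifted step. *)
rewrite -[gpath_label _]mul1g; apply: (reaches_trans (rauzy_fibre pn Sap Scp)).
rewrite /gpath_label /= fgword_cons; apply: (reaches_trans (q := d :: r)).
  exact: reaches_step.
exact: IHs.
Qed.

Lemma rauzy_reaches (A_sub_S : forall a, S [:: a]) n p q g :
  vertices (rauzy_graph S n) p -> vertices (rauzy_graph S n) q ->
  reaches (rauzy_graph S n) p g q.
Proof.
elim: n p q => [|n IHn] p q [Sp pn] [Sq qn].
  move: Sp; rewrite (size0nil pn) (size0nil qn) => S0.
  (* The label is now that of an arbitrary word, so the induction on letters need not preserve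
     reducedness; each letter or inverse letter is a loop at the empty word. *)
  have -> : g = fgword g by apply: val_inj; rewrite /= reduce_id // (valP g).
  elim: (fgval g) => [|x w IHw]; first exact: reaches_refl.
  rewrite fgword_cons; apply: reaches_trans IHw; apply: reaches_step => //.
  by rewrite /gstep; case: x.2; split=> //=; exists x.1.
have tail_vertex a u : S (a :: u) -> size (a :: u) = n.+1 ->
    vertices (rauzy_graph S n) u.
  by move=> Sau [un]; split=> //; exact: factorial_behead Sau.
case: p q pn qn Sp Sq => [|a p] [|b q] // pn qn Sp Sq.
by apply: rauzy_reaches_lift => //; apply: IHn; apply: tail_vertex; eassumption.
Qed.

End RauzyGraphs.

Unset Implicit Arguments.

Theorem theorem4p1 (A : finType) (A_nonempty : (0 < #|A|)%N)
    (S : set (seq A)) (S_recurrent : recurrent S)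
    (S_connected : connected_set S) (A_sub_S : forall a : A, S [:: a])
    (n : nat) (v : seq A) (v_vertex : vertices (rauzy_graph S n) v) :
  group_described (rauzy_graph S n) v = [set: freegroup A].
Proof.
by apply/seteqP; split=> // g _; exact: (rauzy_reaches S_connected A_sub_S).
Qed.
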